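(* Let $\kappa_1\le\kappa_2$ be two nonnegative and nontrivial functions in $C^{1,r}(\partial\omega)$. Let $c_1^*$ and $c_2^*$ be the spreading speeds of solutions of the bulk-surface system described in the context, where the exchange function $\kappa$ is replaced respectively by $\kappa_1$ and $\kappa_2$. Then $c_1^*\ge c_2^*$.
   Context: Setting. $N\ge 1$; $\omega\subset\mathbb{R}^N$ is open, bounded, connected, with smooth boundary (each connected component of $\partial\omega$ is a smooth hypersurface), and $n$ is the exterior unit normal. $d,D,\mu,\nu>0$ are constants, $0<r<1$, and $\kappa\in C^{1,r}(\partial\omega)$ is nonnegative and not identically $0$. The functions $f\in C^{1,r}(\omega\times[0,+\infty))$ and $g\in C^{1,r}(\partial\omega\times[0,+\infty))$ satisfy: $f(\cdot,0)\equiv 0\equiv g(\cdot,0)$; $v\mapsto f(\cdot,v)/v$ is decreasing and $u\mapsto g(\cdot,u)/u$ is nonincreasing; there is $M>0$ such that for all $u,v\ge M$, $f(y,v)\le 0$ for all $y\in\omega$ and $g(y,u)\le0$ for all $y\in\partial\omega$. The system is $\partial_t v=d\Delta v+f(y,v)$ in $\mathbb{R}\times\omega$, $d\,\partial_nv=\kappa(y)(\mu u-\nu v)$ on $\mathbb{R}\times\partial\omega$, $\partial_tu=D\Delta u+g(y,u)+\kappa(y)(\nu v-\mu u)$ on $\mathbb{R}\times\partial\omega$. Its spreading speed $c^*$ in the axial direction is given as follows. For $\alpha\in\mathbb{R}$ let $$\mathcal{F}(\alpha)[U,V]=D\int_{\partial\omega}|\nabla U|^2-\int_{\partial\omega}(D\alpha^2+\partial_u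 g(y,0))U^2+d\int_\omega|\nabla V|^2-\int_\omega(d\alpha^2+\partial_v f(y,0))V^2+\int_{\partial\omega}\kappa(y)(\sqrt{\mu}U-\sqrt{\nu}V)^2$$ for $(U,V)\in H^1(\partial\omega)\times H^1(\omega)$ (traces of $V$ on $\partial\omega$; tangential gradient of $U$, absent when $N=1$), and let the principal eigenvalue be $$\Lambda(\alpha)=\min\Big\{\mathcal{F}(\alpha)[U,V]:\ (U,V)\in H^1(\partial\omega)\times H^1(\omega),\ \int_{\partial\omega}U^2+\int_\omega V^2=1\Big\}.$$ If $\Lambda(0)<0$, then $c^*=\min_{\alpha>0}\frac{-\Lambda(\alpha)}{\alpha}$; if $\Lambda(0)\ge0$, by convention $c^*=0$. *)

(* Defs.v *)
From HB Require Import structures.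
From mathcomp Require Import all_boot all_order all_algebra.
From mathcomp Require Import all_classical all_reals all_analysis.
Set Implicit Arguments.
Unset Strict Implicit.
Unset Printing Implicit Defensive.
Import Order.TTheory GRing.Theory Num.Theory.
Import numFieldNormedType.Exports.
Local Open Scope classical_set_scope.
Local Open Scope ring_scope.

Section calculus.
Context {R : realType}.

(* The canonical norm of 'rV[R]_n is the sup norm: it gives the right topology
   and bounded sets, but lengths and diameters have to be Euclidean. *)
Definition dotv n (x y : 'rV[R]_n) : R := \sum_(i < n) x 0 i * y 0 i.
Definition enorm n (x : 'rV[R]_n) : R := Num.sqrt (dotv x x).

Definition ebase n (i : 'I_n) : 'rV[R]_n := delta_mx 0 i.

Definition grad n (h : 'rV[R]_n -> R) (x : 'rV[R]_n) : 'rV[R]_n :=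
  \row_i 'D_(ebase i) h x.

Fixpoint Ck n (k : nat) (h : 'rV[R]_n -> R) : Prop :=
  continuous h /\
  if k is k'.+1 then
    forall i : 'I_n, (forall x, derivable h x (ebase i)) /\
                     Ck k' (fun x => 'D_(ebase i) h x)
  else True.

Definition smooth n (h : 'rV[R]_n -> R) : Prop := forall k, Ck k h.

Definition smooth_compact_support n (w : set 'rV[R]_n) (h : 'rV[R]_n -> R) :=
  smooth h /\
  exists K : set 'rV[R]_n,
    [/\ compact K, K `<=` w & forall x, ~ K x -> h x = 0].

Definition C1_holder_loc (V : normedModType R) (r : R) (h : V -> R) : Prop :=
  (forall x, differentiable h x) /\
  forall B : set V, bounded_set B -> exists C : R,
    forall x y v, B x -> B y ->
      `|'d h x v - 'd h y v| <= C * `|x - y| `^ r * `|v|.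

(* C^{1,r} on a set, up to its boundary: restriction to the set of a function
   on the whole space whose derivative is r-Hoelder on bounded sets. *)
Definition C1_holder_on (V : normedModType R) (r : R) (E : set V) (h : V -> R) :=
  exists2 H : V -> R, C1_holder_loc r H & forall x, E x -> h x = H x.

(* Derivative at 0 of a function of a variable in [0, +oo[. *)
Definition rderiv0 (h : R -> R) : R :=
  lim ((fun t => (h t - h 0) / t) @ 0^'+).

End calculus.

Section domains.
Context {R : realType} (n : nat).
Implicit Types w W : set 'rV[R]_n.

Definition bdry w : set 'rV[R]_n := closure w `\` interior w.

Definition local_equation w (x : 'rV[R]_n) W (rho : 'rV[R]_n -> R) : Prop :=
  [/\ open W /\ W x, smooth rho, (forall y, W y -> grad rho y != 0) &
      w `&` W = [set y | rho y < 0] `&` W].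

Definition smooth_boundary w : Prop :=
  forall x, bdry w x -> exists W rho, local_equation w x W rho.

Definition smooth_bounded_domain w : Prop :=
  [/\ open w, bounded_set w, connected w, w !=set0 & smooth_boundary w].

(* Exterior unit normal; it does not depend on the local equation. *)
Definition normal w (x : 'rV[R]_n) : 'rV[R]_n :=
  xget 0 [set v | exists W rho, local_equation w x W rho /\
                                v = (enorm (grad rho x))^-1 *: grad rho x].

Definition tangential w (x v : 'rV[R]_n) : 'rV[R]_n :=
  v - dotv v (normal w x) *: normal w x.

End domains.

(* Every set is measurable: the covers in [mu_ext] are then arbitrary. *)
Definition all_measurable (T : Type) : Type := T.

Section all_measurable.
Variable T : pointedType.
HB.instance Definition _ := Pointed.on (all_measurable T).
HB.instance Definition _ := @isMeasurable.Build default_measure_display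
  (all_measurable T) [set: set T] I (fun _ _ => I) (fun _ _ => I).
End all_measurable.

Section measures.
Context {R : realType}.
Local Open Scope ereal_scope.

Definition cover_outer (T : pointedType) (h : set T -> \bar R) (A : set T) :=
  mu_ext (h : set (all_measurable T) -> \bar R) A.

Definition box_gauge n (A : set 'rV[R]_n) : \bar R :=
  if A == set0 then 0 else
  ereal_inf [set v | exists a b : 'rV[R]_n,
    [/\ forall i, (a 0%R i <= b 0%R i)%R,
        forall x, A x -> forall i, (a 0%R i <= x 0%R i <= b 0%R i)%R &
        v = (\prod_(i < n) (b 0%R i - a 0%R i))%R%:E]].

Definition lebesgue_outer n (A : set 'rV[R]_n) : \bar R :=
  cover_outer (@box_gauge n) A.

Definition diam n (A : set 'rV[R]_n) : \bar R :=
  ereal_sup [set (enorm (x - y)%R)%:E | x in A & y in A].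

Definition unit_ball_volume (k : nat) : R :=
  fine (lebesgue_outer [set x : 'rV[R]_k | (enorm x <= 1)%R]).

Definition hausdorff_gauge n (k : nat) (e : R) (A : set 'rV[R]_n) : \bar R :=
  if A == set0 then 0 else
  if diam A <= e%:E
  then (unit_ball_volume k / 2 ^+ k * fine (diam A) ^+ k)%R%:E else +oo.

(* k-dimensional Hausdorff measure, normalised so as to be the k-dimensional
   area on k-dimensional surfaces (and the counting measure if k = 0). *)
Definition hausdorff_outer n (k : nat) (A : set 'rV[R]_n) : \bar R :=
  ereal_sup [set cover_outer (hausdorff_gauge k e) A | e in [set e | (0 < e)%R]].

Section outer_measure_proofs.
Variables (T : pointedType) (h : set T -> \bar R).
Hypotheses (h0 : h set0 = 0) (h_ge0 : forall A, 0 <= h A).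

Lemma cover_outer0 : cover_outer h set0 = 0.
Proof. exact: mu_ext0. Qed.

Lemma cover_outer_ge0 A : 0 <= cover_outer h A.
Proof. exact: mu_ext_ge0. Qed.

Lemma le_cover_outer : {homo cover_outer h : A B / A `<=` B >-> A <= B}.
Proof.
move=> A B AB.
exact: (@le_mu_ext _ (all_measurable T) R (h : set (all_measurable T) -> _)).
Qed.

Lemma cover_outer_sigma_subadditive : sigma_subadditive (cover_outer h).
Proof.
have := @mu_ext_sigma_subadditive _ (all_measurable T) R
  (h : set (all_measurable T) -> _).
by move=> /(_ h_ge0); exact.
Qed.

End outer_measure_proofs.

Lemma box_gauge0 n : box_gauge (set0 : set 'rV[R]_n) = 0.
Proof. by rewrite /box_gauge eqxx. Qed.

Lemma box_gauge_ge0 n (A : set 'rV[R]_n) : 0 <= box_gauge A.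
Proof.
rewrite /box_gauge; case: ifP => // _.
apply: le_ereal_inf_tmp => _ [a [b [ab _ ->]]].
by rewrite lee_fin prodr_ge0 // => i _; rewrite subr_ge0.
Qed.

HB.instance Definition _ n := isOuterMeasure.Build R 'rV[R]_n
  (@lebesgue_outer n) (cover_outer0 (box_gauge0 n) (@box_gauge_ge0 n))
  (cover_outer_ge0 (@box_gauge_ge0 n)) (@le_cover_outer _ (@box_gauge n))
  (cover_outer_sigma_subadditive (@box_gauge_ge0 n)).

Lemma unit_ball_volume_ge0 k : (0 <= unit_ball_volume k)%R.
Proof. by rewrite fine_ge0// outer_measure_ge0. Qed.

Section hausdorff_proofs.
Variables n k : nat.

Lemma hausdorff_gauge0 e : hausdorff_gauge k e (set0 : set 'rV[R]_n) = 0.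
Proof. by rewrite /hausdorff_gauge eqxx. Qed.

Lemma hausdorff_gauge_ge0 e (A : set 'rV[R]_n) : 0 <= hausdorff_gauge k e A.
Proof.
rewrite /hausdorff_gauge; case: eqVneq => [//|/set0P[x Ax]].
case: ifP => // _; rewrite lee_fin mulr_ge0 ?divr_ge0 ?unit_ball_volume_ge0//.
rewrite exprn_ge0// fine_ge0//; apply: ereal_sup_ubound.
exists x => //; exists x => //.
by rewrite /enorm /dotv subrr big1 ?sqrtr0// => i _; rewrite mxE mul0r.
Qed.

Let G0 e := hausdorff_gauge0 e.
Let Gp e := @hausdorff_gauge_ge0 e.

Lemma hausdorff_outer0 : hausdorff_outer k (set0 : set 'rV[R]_n) = 0.
Proof.
rewrite /hausdorff_outer (_ : [set _ | _ in _] = [set 0]) ?ereal_sup1//.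
apply/seteqP; split => [_ [e _ <-]|_ ->] /=; first by rewrite cover_outer0.
by exists 1%R => //; rewrite cover_outer0.
Qed.

Lemma hausdorff_outer_ge0 (A : set 'rV[R]_n) : 0 <= hausdorff_outer k A.
Proof.
apply: (le_trans (cover_outer_ge0 (Gp 1) A)).
by apply: ereal_sup_ubound; exists 1%R => /=.
Qed.

Lemma le_hausdorff_outer :
  {homo @hausdorff_outer n k : A B / A `<=` B >-> A <= B}.
Proof.
move=> A B AB; apply: ge_ereal_sup => _ [e e0 <-].
apply: (le_trans (@le_cover_outer _ (hausdorff_gauge k e) _ _ AB)).
by apply: ereal_sup_ubound; exists e.
Qed.

Lemma hausdorff_outer_sigma_subadditive :
  sigma_subadditive (@hausdorff_outer n k).
Proof.
move=> F; apply: ge_ereal_sup => _ [e e0 <-].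
apply: (le_trans (cover_outer_sigma_subadditive (Gp e) F)).
apply: lee_nneseries => i *; first exact: cover_outer_ge0.
by apply: ereal_sup_ubound; exists e.
Qed.

HB.instance Definition _ := isOuterMeasure.Build R 'rV[R]_n
  (@hausdorff_outer n k) hausdorff_outer0 hausdorff_outer_ge0
  le_hausdorff_outer hausdorff_outer_sigma_subadditive.

End hausdorff_proofs.

(* Restriction to the Caratheodory-measurable sets; for the two outer measures
   above these contain the Borel sets. *)
Definition cara_measure (T : pointedType) (m : {outer_measure set T -> \bar R}) :
  {measure set (caratheodory_type m) -> \bar R} := m.

Definition Leb n := cara_measure (@lebesgue_outer n).

Definition Haus n k := cara_measure (@hausdorff_outer n k).

End measures.

Section sobolev.
Context {R : realType} (n : nat).
Variable w : set 'rV[R]_n.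

Definition inL2 d (T : measurableType d) (m : {measure set T -> \bar R})
    (D : set T) (u : T -> R) : Prop :=
  measurable_fun D u /\ m.-integrable D (fun x => (u x ^+ 2)%:E).

Let leb := @Leb R n.
Let area := @Haus R n n.-1.
Let dw := bdry w.

(* [H] is the weak tangential gradient of [U]: H^1(dw) is the closure of the
   smooth functions for the H^1 norm. *)
Definition is_tgrad (U : 'rV[R]_n -> R) (H : 'rV[R]_n -> 'rV[R]_n) : Prop :=
  [/\ inL2 area dw U, forall i, inL2 area dw (fun x => H x 0 i) &
  exists phi : nat -> 'rV[R]_n -> R,
  [/\ forall k, smooth (phi k),
      (\int[area]_(x in dw) ((phi k x - U x) ^+ 2)%:E)%E @[k --> \oo] --> 0%E &
      (\int[area]_(x in dw)
         (enorm (tangential w x (grad (phi k) x) - H x) ^+ 2)%:E)%E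
        @[k --> \oo] --> 0%E]].

(* [H] is the gradient of [V] in the sense of distributions in [w]. *)
Definition is_wgrad (V : 'rV[R]_n -> R) (H : 'rV[R]_n -> 'rV[R]_n) : Prop :=
  [/\ inL2 leb w V, forall i, inL2 leb w (fun x => H x 0 i) &
  forall phi, smooth_compact_support w phi -> forall i,
    \int[leb]_(x in w) (V x * 'D_(ebase i) phi x) =
    - \int[leb]_(x in w) (H x 0 i * phi x)].

Definition H1_bdry (U : 'rV[R]_n -> R) : Prop := exists H, is_tgrad U H.
Definition H1 (V : 'rV[R]_n -> R) : Prop := exists H, is_wgrad V H.

(* The gradients and the trace are unique up to null sets. *)
Definition tgrad (U : 'rV[R]_n -> R) : 'rV[R]_n -> 'rV[R]_n :=
  xget (fun=> 0) [set H | is_tgrad U H].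
Definition wgrad (V : 'rV[R]_n -> R) : 'rV[R]_n -> 'rV[R]_n :=
  xget (fun=> 0) [set H | is_wgrad V H].

(* The trace extends by continuity the restriction to [dw] of smooth
   functions. *)
Definition is_trace (V T : 'rV[R]_n -> R) : Prop :=
  inL2 area dw T /\
  exists phi : nat -> 'rV[R]_n -> R,
  [/\ forall k, smooth (phi k),
      (\int[leb]_(x in w) ((phi k x - V x) ^+ 2)%:E)%E @[k --> \oo] --> 0%E,
      (\int[leb]_(x in w) (enorm (grad (phi k) x - wgrad V x) ^+ 2)%:E)%E
        @[k --> \oo] --> 0%E &
      (\int[area]_(x in dw) ((phi k x - T x) ^+ 2)%:E)%E
        @[k --> \oo] --> 0%E].

Definition trace (V : 'rV[R]_n -> R) : 'rV[R]_n -> R :=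
  xget (fun=> 0) [set T | is_trace V T].

Variables (d D mu nu : R) (f g : 'rV[R]_n -> R -> R) (kappa : 'rV[R]_n -> R).

Definition energy (a : R) (U V : 'rV[R]_n -> R) : R :=
  D * \int[area]_(x in dw) (enorm (tgrad U x) ^+ 2)
  - \int[area]_(x in dw) ((D * a ^+ 2 + rderiv0 (g x)) * U x ^+ 2)
  + d * \int[leb]_(x in w) (enorm (wgrad V x) ^+ 2)
  - \int[leb]_(x in w) ((d * a ^+ 2 + rderiv0 (f x)) * V x ^+ 2)
  + \int[area]_(x in dw)
      (kappa x * (Num.sqrt mu * U x - Num.sqrt nu * trace V x) ^+ 2).

Definition admissible (U V : 'rV[R]_n -> R) : Prop :=
  [/\ H1_bdry U, H1 V &
      \int[area]_(x in dw) (U x ^+ 2) + \int[leb]_(x in w) (V x ^+ 2) = 1].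

(* The minima defining the principal eigenvalue and the spreading speed are
   attained; [inf] denotes their values. *)
Definition principal_eigenvalue (a : R) : R :=
  inf [set q | exists U V, admissible U V /\ q = energy a U V].

Definition spreading_speed : R :=
  if principal_eigenvalue 0 < 0
  then inf [set - principal_eigenvalue a / a | a in [set a | 0 < a]]
  else 0.

End sobolev.

(* Main.v *)
Require Import Defs.
From HB Require Import structures.
From mathcomp Require Import all_boot all_order all_algebra.
From mathcomp Require Import all_classical all_reals all_analysis.
From mathcomp Require Import zify lra.
Import Order.TTheory GRing.Theory Num.Theory.
Import numFieldNormedType.Exports.
Local Open Scope classical_set_scope.
Local Open Scope ring_scope.

(* The energy is pointwise nondecreasing in kappa, hence so is the principal
   eigenvalue Lambda, and the speed inf_(a > 0) - Lambda(a) / a is nonincreasing.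
   Since [fine +oo = 0] and the [inf] of an unbounded set is 0, this needs the
   exchange integral to be finite and the energies to be bounded below: kappa
   is bounded on the compact boundary, the derivatives of f and g at 0 are
   bounded by the Hoelder condition, and the boundary is measurable because
   the Hausdorff outer measure is additive on separated sets. Finally
   Lambda(a) <= Lambda(0) makes the quotients nonnegative when Lambda(0) < 0. *)

(** * Comparison of integrals of possibly nonmeasurable functions *)

(* The weights [rderiv0 (f y)], [rderiv0 (g y)] and kappa, the gradients and
   the domain w are never shown to be measurable: the library's nonnegative
   integral is a supremum over simple functions, so comparison needs no
   measurability, and scaling holds as an inequality. *)
Section integral_comparison.
Import HBNNSimple.
Local Open Scope ereal_scope.
Context {d} {T : measurableType d} {R : realType} (mu : {measure set T -> \bar R}).
Implicit Types (D : set T) (f : T -> \bar R).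

Lemma ge0_integral_subset D f1 f2 : (forall x, D x -> 0 <= f1 x) ->
  (forall x, D x -> f1 x <= f2 x) ->
  \int[mu]_(x in D) f1 x <= \int[mu]_(x in D) f2 x.
Proof.
move=> f10 f12.
have f20 x : D x -> 0 <= f2 x by move=> Dx; exact: le_trans (f10 _ Dx) (f12 _ Dx).
rewrite !ge0_integralE//; apply: ereal_sup_le => _ [h /= hf <-].
exists h => // x.
apply: (le_trans (hf x)); rewrite /patch; case: ifPn => // /set_mem; exact: f12.
Qed.

Lemma le_integral_nonmeasurable D f1 f2 : (forall x, D x -> f1 x <= f2 x) ->
  \int[mu]_(x in D) f1 x <= \int[mu]_(x in D) f2 x.
Proof.
move=> f12; rewrite integralE [leRHS]integralE.
apply: leeB; apply: ge0_integral_subset => x Dx //.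
  by rewrite !funeposE ge_max !le_max lexx (f12 _ Dx) orbT.
by rewrite !funenegE ge_max !le_max lexx leeN2 (f12 _ Dx) orbT.
Qed.

Lemma integral_fin_num_dominated D f g : (forall x, D x -> `|f x| <= g x) ->
  \int[mu]_(x in D) g x < +oo -> \int[mu]_(x in D) f x \is a fin_num.
Proof.
move=> fg goo; rewrite integralE fin_numB !ge0_fin_numE ?integral_ge0//.
apply/andP; split; apply: le_lt_trans goo; apply: ge0_integral_subset => // x Dx.
  apply: le_trans (fg _ Dx).
  by rewrite !funeposE ge_max abse_ge0 andbT lee_abs.
apply: le_trans (fg _ Dx).
by rewrite !funenegE ge_max abse_ge0 andbT -abseN lee_abs.
Qed.

Lemma ge0_integralZ_le D (k : R) f : (0 <= k)%R -> (forall x, D x -> 0 <= f x) ->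
  \int[mu]_(x in D) (k%:E * f x) <= k%:E * \int[mu]_(x in D) f x.
Proof.
rewrite le_eqVlt => /predU1P[<- f0|k0 f0].
  rewrite mul0e integral0_eq// => x _; exact: mul0e.
rewrite !ge0_integralE//; last by move=> x Dx; rewrite mule_ge0 ?f0// lee_fin ltW.
apply: ge_ereal_sup => _ [h /= hf <-].
have k'0 : (0 <= k^-1)%R by rewrite invr_ge0 ltW.
(* Multiplied by [k^-1], a simple function below [k * f] becomes one below [f]. *)
rewrite -lee_pdivrMl// -sintegralrM.
apply: ereal_sup_ubound; exists (scale_nnsfun h k'0) => // x /=.
rewrite EFinM lee_pdivrMl// (le_trans (hf x))// /patch.
by case: ifPn => //; rewrite mule0.
Qed.

End integral_comparison.

(** * Closed sets and metric outer measures *)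

Section metric_outer_measure.
Context {R : realType} {V : normedModType R} (m : {outer_measure set V -> \bar R}).
Implicit Types A B C X : set V.

(** Caratheodory's metric condition. Only the superadditive half is asked, since every outer measure
    is subadditive. *)
Definition metric_additive := forall A B (e : R), 0 < e ->
  (forall x y, A x -> B y -> e <= `|x - y|) -> (m A + m B <= m (A `|` B))%E.

Hypothesis mm : metric_additive.

Let layer C X k : set V :=
  [set x | X x /\ forall y, C y -> k.+1%:R^-1 <= `|x - y|].

Let layerS C X k : layer C X k `<=` layer C X k.+1.
Proof.
move=> x [Xx kx]; split=> // y /kx; apply: le_trans.
by rewrite lef_pV2 ?posrE ?ltr0n// ler_nat.
Qed.

Let layer_le C X k : layer C X k `<=` X.
Proof. by move=> x []. Qed.

Let layer_far C X k : (m (X `&` C) + m (layer C X k) <= m X)%E.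
Proof.
apply: le_trans (mm (X `&` C) (layer C X k) k.+1%:R^-1 _ _) _.
- by rewrite invr_gt0 ltr0n.
- by move=> x y [_ Cx] [_ /(_ _ Cx)]; rewrite distrC.
- by apply: le_outer_measure => x [[]//|[]].
Qed.

(** Points of the annulus are closer than [k.+2%:R^-1] to [C], points of layer [k] are at least
    [k.+1%:R^-1] away. By the triangle inequality the two sets are separated by the difference. *)
Let layer_gap C X k :
  (m (layer C X k) + m (layer C X k.+2 `\` layer C X k.+1) <= m (layer C X k.+2))%E.
Proof.
set A := layer C X k; set B := _ `\` _.
apply: le_trans (mm A B (k.+1%:R^-1 - k.+2%:R^-1) _ _) _.
- by rewrite subr_gt0 ltf_pV2 ?posrE ?ltr0n// ltr_nat.
- move=> x z [Xx kx] [[Xz _] nz].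
  have [y Cy] : exists2 y, C y & `|z - y| < k.+2%:R^-1.
    apply: contrapT => H; apply: nz; split=> // y Cy.
    by rewrite leNgt; apply/negP => zy; apply: H; exists y.
  move=> zy; rewrite lerBlDr (le_trans (kx _ Cy))//.
  have -> : x - y = (x - z) + (z - y) by rewrite addrA subrK.
  by rewrite (le_trans (ler_normD _ _))// lerD2l ltW.
- apply: le_outer_measure => x [Ax|[]//].
  exact/layerS/layerS.
Qed.

(* The sets [layer C X k] exhaust X \ C; consecutive annuli have separated
   neighbours, so their measures telescope along even and odd indices and
   the tail of the annuli is negligible. *)
Lemma closed_caratheodory C : closed C -> m.-caratheodory C.
Proof.
move=> cC; apply: le_caratheodory_measurable => X.
have [->|Xoo] := eqVneq (m X) +oo%E; first exact: leey.
have mXfin : m X \is a fin_num by rewrite ge0_fin_numE ?outer_measure_ge0// ltey.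
have finS A : A `<=` X -> m A \is a fin_num.
  move=> AX; rewrite ge0_fin_numE ?outer_measure_ge0//.
  by apply: le_lt_trans (le_outer_measure m _ _ AX) _; rewrite ltey.
pose a k := fine (m (layer C X k)).
have aE k : m (layer C X k) = (a k)%:E by rewrite fineK// finS.
pose R_ k := layer C X k.+1 `\` layer C X k.
pose b k := fine (m (R_ k)).
have bE k : m (R_ k) = (b k)%:E.
  by rewrite fineK// finS//; apply: subset_trans (@subDsetl _ _ _) _.
have gap k : a k + b k.+1 <= a k.+2.
  by have := layer_gap C X k; rewrite -/(R_ k.+1) !aE bE -EFinD lee_fin.
pose L := fine (m X) - fine (m (X `&` C)).
have aL k : a k <= L.
  rewrite lerBrDl -lee_fin EFinD -aE !fineK ?layer_far//.
  by apply: finS => x [].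
(* Each [gap] bounds an annulus by the increment of [a] over two indices, so two terms survive at
   each end of the sum. *)
have tele k n : \sum_(0 <= j < n) b (k + j)%N.+1 <=
    a (k + n)%N + a (k + n)%N.+1 - a k - a k.+1.
  elim: n => [|n IH]; first by rewrite big_geq// addn0; lra.
  rewrite big_nat_recr//=; have := gap (k + n)%N; rewrite addnS => g1.
  by move: IH g1; lra.
have anbnd : has_sup (range a).
  by split; [exists (a 0), 0|exists L => _ [k _ <-]].
pose S := sup (range a).
have aS k : a k <= S by apply: sup_ubound; [case: anbnd|exists k].
have mA k : fine (m (X `&` ~` C)) <= S + (S + S - a k - a k.+1).
  rewrite -lee_fin fineK; last by apply: finS => x [].
  have sub : X `&` ~` C `<=` layer C X k.+1 `|` \bigcup_j R_ (k + j)%N.+1.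
    move=> x [Xx nCx].
    have [e /= e0 xe] : exists2 e : R, 0 < e & forall y, C y -> e <= `|x - y|.
      have /nbhs_ballP[e /= e0 eC] : nbhs x (~` C).
        by apply: open_nbhs_nbhs; split => //; exact: closed_openC.
      exists e => // y Cy; rewrite leNgt; apply/negP => xy.
      by apply: (eC y) => //; rewrite -ball_normE.
    have [j ej] : exists j, layer C X (k + j)%N.+1 x.
      (* Since [j + 1 > 1 / e], the distance required by layer [k + j + 1] is at most [e]. *)
      pose j := Num.truncn e^-1; exists j; split => // y Cy.
      rewrite (le_trans _ (xe _ Cy))// -[leRHS]invrK lef_pV2 ?posrE ?ltr0n ?invr_gt0//.
      rewrite (le_trans (ltW (truncnS_gt _)))// ler_nat -/j; lia.
    (* Descent on [j]: either [x] is already in the previous layer, or it lies in the annulus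
       between the two. *)
    have := ej; elim: j {ej} => [|j IH]; first by rewrite addn0; left.
    rewrite addnS => lj.
    have [lj'|nlj] := pselect (layer C X (k + j)%N.+1 x); first exact: IH.
    by right; exists j.
  apply: le_trans (le_outer_measure m _ _ sub) _.
  apply: le_trans (outer_measureU2 _ _ _) _.
  rewrite EFinD aE leeD ?lee_fin//.
  apply: le_trans (outer_measure_sigma_subadditive m _) _.
  apply: lime_le; first by apply: is_cvg_nneseries => *; exact: outer_measure_ge0.
  apply: nearW => n; under eq_bigr do rewrite bE.
  by rewrite sumEFin lee_fin (le_trans (tele k n))// !lerD2r lerD.
have mAS : fine (m (X `&` ~` C)) <= S.
  apply/ler_addgt0Pr => e e0.
  (* As [a] is nondecreasing, the excess in [mA] is at most [2 (S - a k)]; approaching [S] within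
     [e / 2] is enough. *)
  have e20 : 0 < e / 2 by rewrite divr_gt0.
  have [_ [k _ <-] ak] := sup_adherent e20 anbnd.
  have : a k <= a k.+1 by rewrite -lee_fin -!aE le_outer_measure.
  by move: (mA k) ak; rewrite -/S; lra.
have SL : S <= L by apply: ge_sup => [|_ [k _ <-]]//; case: anbnd.
have XC : m (X `&` C) \is a fin_num by apply: finS => x [].
have XnC : m (X `&` ~` C) \is a fin_num by apply: finS => x [].
rewrite -(fineK XC) -(fineK XnC) -(fineK mXfin) -EFinD lee_fin -lerBrDl.
exact: le_trans mAS SL.
Qed.
End metric_outer_measure.

(** * Measurability of closed sets for the Hausdorff measure *)

Section hausdorff_measurability.
Context {R : realType}.

(** A cover of the union contains a cover of [A], the pieces that meet [A], and likewise one of [B].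
    A piece in both has infinite gauge, so no finite term is counted twice. *)
Lemma cover_outer_superadditive (T : pointedType) (h : set T -> \bar R)
    (A B : set T) : h set0 = 0%E -> (forall F, 0 <= h F)%E ->
  (forall F, F `&` A !=set0 -> F `&` B !=set0 -> h F = +oo%E) ->
  (cover_outer h A + cover_outer h B <= cover_outer h (A `|` B))%E.
Proof.
move=> h0 hp hAB; apply: le_ereal_inf_tmp => _ [F [_ Fcov] <-].
pose G (X : set T) i := if asbool (F i `&` X !=set0) then F i else set0.
have cG X : X `<=` A `|` B -> (cover_outer h X <= \sum_(0 <= i <oo) h (G X i))%E.
  move=> XAB; apply: ereal_inf_lbound; exists (G X) => //; split=> // x Xx.
  have [i _ Fix] := Fcov _ (XAB _ Xx); exists i => //.
  by rewrite /G; case: asboolP => // -[]; exists x.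
apply: le_trans (leeD (cG A (@subsetUl _ _ _)) (cG B (@subsetUr _ _ _))) _.
rewrite -nneseriesD => [|? ? _|? ? _]; [|exact: hp..].
apply: lee_nneseries => [i _ _|i _]; first by apply: adde_ge0; exact: hp.
rewrite /G; case: asboolP => FA; case: asboolP => FB; rewrite ?h0 ?adde0 ?add0e//.
by rewrite (hAB _ FA FB).
Qed.

(** Separation of sets is measured in the sup norm and diameters are Euclidean; this links the
    two. *)
Lemma ler_norm_enorm n (x : 'rV[R]_n) : `|x| <= enorm x.
Proof.
rewrite {1}/Num.norm /= mx_normrE; apply: bigmax_le => [|[i j] _]; first exact: sqrtr_ge0.
rewrite ord1 /= -sqrtr_sqr ler_wsqrtr// /dotv (bigD1 j)//= expr2 lerDl.
by apply: sumr_ge0 => k _; rewrite -expr2 sqr_ge0.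
Qed.

Lemma hausdorff_gauge_antimono n k (e e' : R) (A : set 'rV[R]_n) : e <= e' ->
  (hausdorff_gauge k e' A <= hausdorff_gauge k e A)%E.
Proof.
move=> ee'; rewrite /hausdorff_gauge; case: ifP => // _.
case: (boolP (diam A <= e%:E)%E) => Ae; last by rewrite leey.
by rewrite (le_trans Ae) ?lee_fin.
Qed.

Lemma cover_hausdorff_antimono n k (e e' : R) (A : set 'rV[R]_n) : e <= e' ->
  (cover_outer (hausdorff_gauge k e') A <= cover_outer (hausdorff_gauge k e) A)%E.
Proof.
move=> ee'; apply: le_ereal_inf_tmp => _ [F Fcov <-].
apply: (@le_trans _ _ (\sum_(0 <= i <oo) hausdorff_gauge k e' (F i))%E).
  by apply: ereal_inf_lbound; exists F.
apply: lee_nneseries => [i _ _|i _]; first exact: hausdorff_gauge_ge0.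
exact: hausdorff_gauge_antimono.
Qed.

(** At a scale below [e], a set meeting both [A] and [B] has infinite gauge, so superadditivity
    holds at small scales and passes to the supremum. *)
Lemma hausdorff_metric_additive n k :
  metric_additive (@hausdorff_outer R n k : {outer_measure set 'rV[R]_n -> \bar R}).
Proof.
move=> A B e e0 AB.
change (hausdorff_outer k A + hausdorff_outer k B <= hausdorff_outer k (A `|` B))%E.
have [->|Xoo] := eqVneq (hausdorff_outer k (A `|` B)) +oo%E; first exact: leey.
have Xfin : hausdorff_outer k (A `|` B) \is a fin_num.
  by rewrite ge0_fin_numE ?outer_measure_ge0// ltey.
(* With two independent scales, the suprema defining the two measures can be taken one after the
   other. *)
have key e1 e2 : 0 < e1 -> 0 < e2 -> (cover_outer (hausdorff_gauge k e1) A +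
    cover_outer (hausdorff_gauge k e2) B <= hausdorff_outer k (A `|` B))%E.
  move=> e10 e20; pose e3 := Num.min (e / 2) (Num.min e1 e2).
  have e30 : 0 < e3 by rewrite !lt_min e10 e20 divr_gt0.
  have [e31 e32] : e3 <= e1 /\ e3 <= e2 by rewrite !ge_min !lexx !orbT.
  have e3e : e3 < e by rewrite gt_min [X in X || _](_ : _ = true)//; lra.
  apply: le_trans (leeD (cover_hausdorff_antimono n k _ _ A e31)
                        (cover_hausdorff_antimono n k _ _ B e32)) _.
  apply: (@le_trans _ _ (cover_outer (hausdorff_gauge k e3) (A `|` B))).
    apply: cover_outer_superadditive; first exact: hausdorff_gauge0.
      exact: hausdorff_gauge_ge0.
    move=> F [x [Fx Ax]] [y [Fy By]]; rewrite /hausdorff_gauge.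
    case: eqVneq => [F0|_]; first by rewrite F0 in Fx.
    case: ifPn => //; rewrite leNgt => /negP[].
    apply: (@lt_le_trans _ _ (enorm (x - y))%:E).
      by rewrite lte_fin (lt_le_trans e3e)// (le_trans (AB _ _ Ax By))// ler_norm_enorm.
    by apply: ereal_sup_ubound; exists x => //; exists y.
  by apply: ereal_sup_ubound; exists e3.
rewrite -leeBrDr//; last first.
  rewrite ge0_fin_numE ?outer_measure_ge0//.
  apply: le_lt_trans (le_outer_measure _ _ _ (@subsetUr _ A B)) _.
  by rewrite ltey.
apply: ge_ereal_sup => _ [e1 /= e10 <-].
have c1fin : cover_outer (hausdorff_gauge k e1) A \is a fin_num.
  rewrite ge0_fin_numE; last exact: cover_outer_ge0 (@hausdorff_gauge_ge0 _ _ _ _) _.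
  apply: (@le_lt_trans _ _ (hausdorff_outer k (A `|` B))); last by rewrite ltey.
  rewrite (le_trans _ (key _ _ e10 ltr01))// leeDl//.
  exact: cover_outer_ge0 (@hausdorff_gauge_ge0 _ _ _ _) _.
rewrite leeBrDr; last first.
  rewrite ge0_fin_numE ?outer_measure_ge0//.
  apply: le_lt_trans (le_outer_measure _ _ _ (@subsetUr _ A B)) _.
  by rewrite ltey.
rewrite -leeBrDl//; apply: ge_ereal_sup => _ [e2 /= e20 <-].
by rewrite leeBrDl// key.
Qed.

(** Meant for the boundary, as linearity of integrability requires a measurable domain. *)
Lemma closed_measurable_Haus n k (C : set 'rV[R]_n) : closed C ->
  measurable (C : set (caratheodory_type (@hausdorff_outer R n k))).
Proof.
by move=> cC; apply: closed_caratheodory => //; exact: hausdorff_metric_additive.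
Qed.

End hausdorff_measurability.

(** * Bounds from the regularity assumptions *)

Section regularity.
Context {R : realType}.

Lemma bounded_setP (V : normedModType R) (A : set V) :
  bounded_set A <-> exists M : R, 0 <= M /\ forall x, A x -> `|x| <= M.
Proof.
split=> [[M [_ hM]]|[M [M0 hM]]].
  exists (`|M| + 1); split; first by rewrite addr_ge0.
  by apply: hM; rewrite (le_lt_trans (ler_norm M))// ltrDl.
exists M; split; first exact: num_real.
by move=> M' MM' x /hM xM; apply: le_trans xM (ltW MM').
Qed.

Lemma bounded_closure (V : normedModType R) (A : set V) :
  bounded_set A -> bounded_set (closure A).
Proof.
move=> /bounded_setP[M [M0 AM]]; apply/bounded_setP; exists M; split => //.
have cM : closed [set x : V | `|x| <= M].
  by apply: (@preimage_closed _ _ (@Num.norm R V) [set y | y <= M]) => [x _|];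
    [exact: norm_continuous|exact: closed_le].
by move=> x /(closure_subset AM) ; rewrite -((closure_id _).1 cM).
Qed.

Lemma bounded_bdry n (w : set 'rV[R]_n) : bounded_set w -> bounded_set (bdry w).
Proof.
move=> /bounded_closure/bounded_setP[M [M0 wM]].
by apply/bounded_setP; exists M; split=> // x [/wM].
Qed.

Lemma closed_bdry n (w : set 'rV[R]_n) : closed (bdry w).
Proof.
apply: closedI; first exact: closed_closure.
exact/open_closedC/open_interior.
Qed.

Lemma C1_holder_on_bounded n (r : R) (E : set 'rV[R]_n) (h : 'rV[R]_n -> R) :
  bounded_set E -> closed E -> C1_holder_on r E h ->
  exists C : R, 0 <= C /\ forall x, E x -> `|h x| <= C.
Proof.
move=> bE cE [H [dH _] hH].
have : compact (H @` E).
  apply: continuous_compact; last exact: bounded_closed_compact.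
  by apply: continuous_subspaceT => x; exact: differentiable_continuous.
move=> /compact_bounded/bounded_setP[C [C0 HC]]; exists C; split => // x Ex.
by rewrite hH//; apply: HC; exists x.
Qed.

(** For [t > 0] the quotient of [h] is that of [H] in the direction [(0, 1)], whose two-sided limit
    exists by differentiability. *)
Lemma rderiv0_differentiable n (H : 'rV[R]_n * R -> R) (h : R -> R) y :
  differentiable H (y, 0) -> (forall t, 0 <= t -> h t = H (y, t)) ->
  rderiv0 h = 'd H (y, 0) (0, 1).
Proof.
move=> dH hH; apply: cvg_lim => //; rewrite -deriveE//.
have := @diff_derivable _ _ _ _ _ ((0, 1) : 'rV[R]_n * R) dH => /cvg_ex[l Hl].
have /cvg_dnbhs_at_right := Hl.
have -> : 'D_((0, 1) : 'rV[R]_n * R) H (y, 0) = l by exact: cvg_lim Hl.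
apply: cvg_trans; apply: near_eq_cvg; near=> t.
have t0 : 0 < t by near: t; exact: nbhs_right_gt.
rewrite /= !hH ?(ltW t0)// [RHS]mulrC; congr (_ * (H _ - _)).
rewrite -[LHS]/(t *: (0 : 'rV[R]_n) + y, t * 1 + 0).
by rewrite scaler0 add0r mulr1 addr0.
Unshelve. all: by end_near. Qed.

(** On the slice [t = 0] the derivative is the differential of the extension along [(0, 1)]; the
    Hoelder condition compares it with its value at one fixed point [y0]. *)
Lemma rderiv0_bounded n (r : R) (E : set 'rV[R]_n) (h : 'rV[R]_n -> R -> R) :
  0 < r -> bounded_set E ->
  @C1_holder_on R ('rV[R]_n * R)%type r [set z | E z.1 /\ 0 <= z.2]
    (fun z => h z.1 z.2) ->
  exists C : R, 0 <= C /\ forall y, E y -> `|rderiv0 (h y)| <= C.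
Proof.
move=> r0 /bounded_setP[M [M0 EM]] [H [dH holdH] hH].
have [[y0 Ey0]|E0] := pselect (E !=set0); last first.
  by exists 0; split=> // y Ey; case: E0; exists y.
pose B := [set z : 'rV[R]_n * R | E z.1 /\ z.2 = 0].
have BM z : B z -> `|z| <= M.
  by move=> [Ez z0]; rewrite prod_normE z0 normr0 ge_max M0 EM.
have [C hC] : exists C : R, forall x y v, B x -> B y ->
    `|'d H x v - 'd H y v| <= C * `|x - y| `^ r * `|v|.
  by apply: holdH; apply/bounded_setP; exists M.
have [phi hphi phiC] : exists2 phi : 'rV[R]_n * R -> R,
    (forall y, E y -> rderiv0 (h y) = phi (y, 0)) &
    exists K : R, 0 <= K /\
      forall x y, B x -> B y -> `|phi x - phi y| <= C * `|x - y| `^ r * K.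
  exists (fun z => 'd H z (0, 1)) => [y Ey|].
    by apply: rderiv0_differentiable => // t t0; exact: (hH (y, t)).
  exists `|((0, 1) : 'rV[R]_n * R)|; split => // x y Bx By; exact: hC.
have {phiC}[K [K0 phiC]] := phiC; clear hC.
(* The value at [y0] plus the Hoelder oscillation over distances at most [M + M]; the sign of [C] is
   unknown, hence its absolute value. *)
exists (`|phi (y0, 0)| + `|C| * (M + M) `^ r * K); split.
  by rewrite !(addr_ge0, mulr_ge0) ?powR_ge0.
move=> y Ey; rewrite hphi//.
have By : B (y, 0) by [].
have By0 : B (y0, 0) by [].
have yM : `|(y, 0 : R) - (y0, 0)| <= M + M.
  by rewrite (le_trans (ler_normB _ _))// lerD// BM.
have yMr : `|(y, 0 : R) - (y0, 0)| `^ r <= (M + M) `^ r.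
  by apply: ge0_ler_powR => //; rewrite ?nnegrE ?(ltW r0)// addr_ge0.
rewrite -lerBlDl (le_trans (lerB_dist _ _))// (le_trans (phiC _ _ By By0))//.
rewrite ler_wpM2r// (@le_trans _ _ (`|C| * `|(y, 0 : R) - (y0, 0)| `^ r))//.
  by rewrite ler_wpM2r ?powR_ge0 ?ler_norm.
by rewrite ler_wpM2l.
Qed.

End regularity.

(** * The energy and the principal eigenvalue *)

Section Rintegral_comparison.
Context {d} {T : measurableType d} {R : realType} (mu : {measure set T -> \bar R}).
Implicit Types (D : set T) (f g u h : T -> R).

(** [fine] sends infinite values to 0, which would break monotonicity; the common bound [g] makes
    both integrals finite. *)
Lemma le_Rintegral_dominated D f1 f2 g : (forall x, D x -> f1 x <= f2 x) ->
  (forall x, D x -> `|f1 x| <= g x) -> (forall x, D x -> `|f2 x| <= g x) ->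
  (\int[mu]_(x in D) (g x)%:E < +oo)%E ->
  \int[mu]_(x in D) f1 x <= \int[mu]_(x in D) f2 x.
Proof.
move=> f12 f1g f2g goo; apply: fine_le.
- by apply: integral_fin_num_dominated goo => x Dx; rewrite lee_fin f1g.
- by apply: integral_fin_num_dominated goo => x Dx; rewrite lee_fin f2g.
- by apply: le_integral_nonmeasurable => x Dx; rewrite lee_fin f12.
Qed.

Lemma inL2_lty D u : inL2 mu D u -> (\int[mu]_(x in D) (u x ^+ 2)%:E < +oo)%E.
Proof.
move=> [_ /integrableP[_]]; under eq_integral do rewrite gee0_abs ?lee_fin ?sqr_ge0//.
by [].
Qed.

Lemma inL2_scale_lty D u (C : R) : 0 <= C -> inL2 mu D u ->
  (\int[mu]_(x in D) (C * u x ^+ 2)%:E < +oo)%E.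
Proof.
move=> C0 u2; under eq_integral do rewrite EFinM.
apply: le_lt_trans (ge0_integralZ_le _ _ _ _ C0 _) _.
  by move=> x _; rewrite lee_fin sqr_ge0.
by rewrite lte_mul_pinfty// inL2_lty.
Qed.

Lemma Rintegral_weight_le D u h (C : R) : 0 <= C -> inL2 mu D u ->
  (forall x, D x -> `|h x| <= C) ->
  \int[mu]_(x in D) (h x * u x ^+ 2) <= C * \int[mu]_(x in D) (u x ^+ 2).
Proof.
move=> C0 u2 hC.
have ufin : (\int[mu]_(x in D) (u x ^+ 2)%:E)%E \is a fin_num.
  rewrite ge0_fin_numE ?inL2_lty// integral_ge0// => x _.
  by rewrite lee_fin sqr_ge0.
have dom x : D x -> `|h x * u x ^+ 2| <= C * u x ^+ 2.
  by move=> Dx; rewrite normrM (ger0_norm (sqr_ge0 (u x))) ler_wpM2r ?sqr_ge0// hC.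
rewrite -[X in X * _]/(fine C%:E) -fineM//; apply: fine_le.
- apply: integral_fin_num_dominated (inL2_scale_lty D u _ C0 u2) => x Dx.
  by rewrite lee_fin dom.
- by rewrite fin_numM.
apply: le_trans (ge0_integralZ_le _ _ _ _ C0 _); last first.
  by move=> x _; rewrite lee_fin sqr_ge0.
apply: le_integral_nonmeasurable => x Dx.
by rewrite -EFinM lee_fin (le_trans (ler_norm _))// dom.
Qed.

Lemma inL2_sub_lty D u v (K a b : R) : measurable D -> 0 <= K ->
  inL2 mu D u -> inL2 mu D v ->
  (\int[mu]_(x in D) (K * (a * u x - b * v x) ^+ 2)%:E < +oo)%E.
Proof.
move=> mD K0 [_ u2] [_ v2].
have iu := integrableZl mD (2 * K * a ^+ 2) u2.
have iv := integrableZl mD (2 * K * b ^+ 2) v2.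
have /integrableP[_] := integrableD mD iu iv.
apply: le_lt_trans; apply: le_integral_nonmeasurable => x Dx.
rewrite /= lee_fin ger0_norm; last first.
  by apply: addr_ge0; apply: mulr_ge0; rewrite ?sqr_ge0// mulr_ge0 ?sqr_ge0// mulr_ge0.
(* The gap is a square: [2 (a u)^2 + 2 (b v)^2 - (a u - b v)^2 = (a u + b v)^2]. *)
have : 0 <= K * (a * u x + b * v x) ^+ 2 by rewrite mulr_ge0 ?sqr_ge0.
nra.
Qed.

End Rintegral_comparison.

(** * Bounds and monotonicity of the energy, then comparison of the speeds *)

Section energy_bounds.
Context {R : realType} (N : nat) (w : set 'rV[R]_N).
Variables (d D mu nu : R) (f g : 'rV[R]_N -> R -> R).
Hypotheses (hd : 0 < d) (hD : 0 < D).
Variables (Cf Cg : R).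
Hypotheses (Cf0 : 0 <= Cf) (Cg0 : 0 <= Cg).
Hypothesis fC : forall y, w y -> `|rderiv0 (f y)| <= Cf.
Hypothesis gC : forall y, bdry w y -> `|rderiv0 (g y)| <= Cg.
Implicit Types (kappa U V : 'rV[R]_N -> R).

Lemma inL2_H1_bdry U : H1_bdry w U -> inL2 (@Haus R N N.-1) (bdry w) U.
Proof. by move=> [H []]. Qed.

Lemma inL2_H1 V : H1 w V -> inL2 (@Leb R N) w V.
Proof. by move=> [H []]. Qed.

Lemma inL2_trace V : inL2 (@Haus R N N.-1) (bdry w) (trace w V).
Proof.
(* Without a trace, [xget] returns the zero function, which is square integrable too. *)
rewrite /trace; case: xgetP => [T _ []//|_]; split; first exact: measurable_cst.
by under eq_fun do rewrite expr0n; exact: integrable0.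
Qed.

Lemma weight_le (D' C a h : R) : 0 < D' -> `|h| <= C ->
  `|D' * a ^+ 2 + h| <= D' * a ^+ 2 + C.
Proof.
move=> D0 hC; rewrite (le_trans (ler_normD _ _))// lerD//.
by rewrite ger0_norm// mulr_ge0 ?sqr_ge0// ltW.
Qed.

Lemma weight_ge0 (D' C a : R) : 0 < D' -> 0 <= C -> 0 <= D' * a ^+ 2 + C.
Proof. by move=> D0 C0; rewrite addr_ge0// mulr_ge0 ?sqr_ge0// ltW. Qed.

(** The gradient and exchange terms are nonnegative, and the normalisation leaves at most mass 1
    under each bounded weight. *)
Lemma energy_ge kappa (a : R) U V : (forall y, bdry w y -> 0 <= kappa y) ->
  admissible w U V ->
  - (D * a ^+ 2 + Cg) - (d * a ^+ 2 + Cf) <= energy w d D mu nu f g kappa a U V.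
Proof.
move=> k0 [/inL2_H1_bdry U2 /inL2_H1 V2 UV1]; rewrite /energy.
have Wg := weight_ge0 D Cg a hD Cg0; have Wf := weight_ge0 d Cf a hd Cf0.
have gw x : bdry w x -> `|D * a ^+ 2 + rderiv0 (g x)| <= D * a ^+ 2 + Cg.
  by move=> /gC; exact: weight_le.
have fw x : w x -> `|d * a ^+ 2 + rderiv0 (f x)| <= d * a ^+ 2 + Cf.
  by move=> /fC; exact: weight_le.
have gU := Rintegral_weight_le _ _ _ _ _ Wg U2 gw.
have fV := Rintegral_weight_le _ _ _ _ _ Wf V2 fw.
move: UV1 gU fV.
set iU := \int[@Haus R N N.-1]_(x in bdry w) (U x ^+ 2).
set iV := \int[@Leb R N]_(x in w) (V x ^+ 2).
set iG := \int[@Haus R N N.-1]_(x in bdry w) ((D * a ^+ 2 + rderiv0 (g x)) * U x ^+ 2).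
set iF := \int[@Leb R N]_(x in w) ((d * a ^+ 2 + rderiv0 (f x)) * V x ^+ 2).
set dU := \int[@Haus R N N.-1]_(x in bdry w) (enorm (tgrad w U x) ^+ 2).
set dV := \int[@Leb R N]_(x in w) (enorm (wgrad w V x) ^+ 2).
set iK := \int[@Haus R N N.-1]_(x in bdry w)
  (kappa x * (Num.sqrt mu * U x - Num.sqrt nu * trace w V x) ^+ 2).
have iU0 : 0 <= iU by apply: Rintegral_ge0 => x _; exact: sqr_ge0.
have iV0 : 0 <= iV by apply: Rintegral_ge0 => x _; exact: sqr_ge0.
have dU0 : 0 <= D * dU.
  by rewrite mulr_ge0 ?(ltW hD)//; apply: Rintegral_ge0 => x _; exact: sqr_ge0.
have dV0 : 0 <= d * dV.
  by rewrite mulr_ge0 ?(ltW hd)//; apply: Rintegral_ge0 => x _; exact: sqr_ge0.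
have iK0 : 0 <= iK.
  by apply: Rintegral_ge0 => x /k0 ?; rewrite mulr_ge0 ?sqr_ge0.
move=> UV1 gU fV.
have gU' : iG <= D * a ^+ 2 + Cg.
  by rewrite (le_trans gU)// ler_piMr//; lra.
have fV' : iF <= d * a ^+ 2 + Cf.
  by rewrite (le_trans fV)// ler_piMr//; lra.
lra.
Qed.

(** [a] enters only through [D * a ^+ 2] and [d * a ^+ 2] in the subtracted weights. The weight
    bounds at [a] dominate the integrands both at [a] and at 0. *)
Lemma energy_le_energy0 kappa (a : R) U V : admissible w U V ->
  energy w d D mu nu f g kappa a U V <= energy w d D mu nu f g kappa 0 U V.
Proof.
move=> [/inL2_H1_bdry U2 /inL2_H1 V2 _]; rewrite /energy lerD2r.
have shrink (D' C h u : R) : 0 < D' -> 0 <= C -> `|h| <= C ->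
    [/\ (D' * 0 ^+ 2 + h) * u ^+ 2 <= (D' * a ^+ 2 + h) * u ^+ 2,
        `|(D' * 0 ^+ 2 + h) * u ^+ 2| <= (D' * a ^+ 2 + C) * u ^+ 2 &
        `|(D' * a ^+ 2 + h) * u ^+ 2| <= (D' * a ^+ 2 + C) * u ^+ 2].
  move=> D0 C0 hC; rewrite expr0n mulr0 add0r; move: (u ^+ 2) (sqr_ge0 u) => v v0.
  rewrite !normrM !(ger0_norm v0).
  have Da : 0 <= D' * a ^+ 2 by rewrite mulr_ge0 ?sqr_ge0// ltW.
  by split; rewrite ler_wpM2r ?weight_le ?lerDr// ler_wpDl.
have gU := inL2_scale_lty _ _ _ _ (weight_ge0 D Cg a hD Cg0) U2.
have fV := inL2_scale_lty _ _ _ _ (weight_ge0 d Cf a hd Cf0) V2.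
apply: lerB; [apply: lerD => //; apply: lerB => //|].
- by apply: le_Rintegral_dominated gU => x wx;
    have [] := shrink D Cg _ (U x) hD Cg0 (gC x wx).
- by apply: le_Rintegral_dominated fV => x wx;
    have [] := shrink d Cf _ (V x) hd Cf0 (fC x wx).
Qed.

(** [K] times the squared difference dominates both exchange integrands; its integral is finite
    because [U] and the trace are square integrable. *)
Lemma energy_le_kappa kappa1 kappa2 (K a : R) U V :
  (forall y, bdry w y -> 0 <= kappa1 y <= kappa2 y) ->
  (forall y, bdry w y -> kappa2 y <= K) -> 0 <= K ->
  admissible w U V ->
  energy w d D mu nu f g kappa1 a U V <= energy w d D mu nu f g kappa2 a U V.
Proof.
move=> k12 kK K0 [/inL2_H1_bdry U2 _ _]; rewrite /energy lerD2l.
have mw := closed_measurable_Haus N N.-1 _ (closed_bdry N w).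
have dom := inL2_sub_lty _ _ _ _ K (Num.sqrt mu) (Num.sqrt nu) mw K0 U2 (inL2_trace V).
apply: le_Rintegral_dominated dom => x wx; have /andP[k1 k2] := k12 _ wx.
- by rewrite ler_wpM2r ?sqr_ge0.
- rewrite normrM !ger0_norm ?sqr_ge0// ler_wpM2r ?sqr_ge0//.
  by rewrite (le_trans k2) ?kK.
- rewrite normrM !ger0_norm ?sqr_ge0// ?(le_trans k1)// ler_wpM2r ?sqr_ge0//.
  by rewrite kK.
Qed.

Let energies kappa a :=
  [set q | exists U V, admissible w U V /\ q = energy w d D mu nu f g kappa a U V].

Let energies_lbound kappa a : (forall y, bdry w y -> 0 <= kappa y) ->
  has_lbound (energies kappa a).
Proof.
move=> k0; exists (- (D * a ^+ 2 + Cg) - (d * a ^+ 2 + Cf)).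
by move=> _ [U [V [UV ->]]]; exact: energy_ge.
Qed.

Let inf_energies_le kappa kappa' a a' : (forall y, bdry w y -> 0 <= kappa y) ->
  (forall U V, admissible w U V -> energy w d D mu nu f g kappa a U V <=
                                   energy w d D mu nu f g kappa' a' U V) ->
  principal_eigenvalue w d D mu nu f g kappa a <=
  principal_eigenvalue w d D mu nu f g kappa' a'.
Proof.
move=> k0 EE; rewrite /principal_eigenvalue -/(energies kappa a) -/(energies kappa' a').
have [[q [U [V [UV qE]]]]|E0] := pselect (energies kappa' a' !=set0).
  apply: lb_le_inf; first by exists q, U, V.
  move=> _ [U' [V' [UV' ->]]]; apply: le_trans (EE _ _ UV').
  apply: (ge_inf (energies_lbound kappa a k0)).
  by exists U', V'; split; [exact: UV'|reflexivity].
(* Admissibility depends on neither [kappa] nor [a]: if no pair is admissible, both sets are empty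
   and their [inf] coincide. *)
have nadm U V : ~ admissible w U V.
  by move=> UV; apply: E0; exists (energy w d D mu nu f g kappa' a' U V), U, V.
have e0 k b : energies k b = set0.
  by apply/seteqP; split=> q // [U [V [/nadm]]].
by rewrite !e0.
Qed.

Lemma principal_eigenvalue_le_at0 kappa a : (forall y, bdry w y -> 0 <= kappa y) ->
  principal_eigenvalue w d D mu nu f g kappa a <=
  principal_eigenvalue w d D mu nu f g kappa 0.
Proof.
by move=> k0; apply: inf_energies_le => // U V; exact: energy_le_energy0.
Qed.

Lemma principal_eigenvalue_le_kappa kappa1 kappa2 (K a : R) :
  (forall y, bdry w y -> 0 <= kappa1 y <= kappa2 y) ->
  (forall y, bdry w y -> kappa2 y <= K) -> 0 <= K ->
  principal_eigenvalue w d D mu nu f g kappa1 a <=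
  principal_eigenvalue w d D mu nu f g kappa2 a.
Proof.
move=> k12 kK K0; apply: inf_energies_le => [y /k12/andP[]//|U V].
exact: energy_le_kappa k12 kK K0.
Qed.

(** Since [L1 0 <= L2 0], a negative [L2 0] forces a negative [L1 0], and the quotients then compare
    for each [a]. *)
Lemma spreading_speed_le_kappa kappa1 kappa2 (K : R) :
  (forall y, bdry w y -> 0 <= kappa1 y <= kappa2 y) ->
  (forall y, bdry w y -> kappa2 y <= K) -> 0 <= K ->
  spreading_speed w d D mu nu f g kappa2 <= spreading_speed w d D mu nu f g kappa1.
Proof.
move=> k12 kK K0; rewrite /spreading_speed.
set L1 := principal_eigenvalue w d D mu nu f g kappa1.
set L2 := principal_eigenvalue w d D mu nu f g kappa2.
have L12 a : L1 a <= L2 a by exact: principal_eigenvalue_le_kappa k12 kK K0.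
have k10 y : bdry w y -> 0 <= kappa1 y by move=> /k12/andP[].
have k20 y : bdry w y -> 0 <= kappa2 y.
  by move=> /k12/andP[k1 k2]; exact: le_trans k2.
have speed_ge0 (L : R -> R) (a : R) :
    (forall b, L b <= L 0) -> L 0 < 0 -> 0 < a -> 0 <= - L a / a.
  move=> LL L0 a0; rewrite divr_ge0 ?(ltW a0)// oppr_ge0.
  exact: le_trans (LL a) (ltW L0).
have L1le b : L1 b <= L1 0 by exact: principal_eigenvalue_le_at0.
have L2le b : L2 b <= L2 0 by exact: principal_eigenvalue_le_at0.
case: ltP => [L20|_]; last first.
  (* The speed for [kappa2] is 0 by convention, so it remains to see that the one for [kappa1] is
     nonnegative. *)
  case: ltP => // L10; apply: lb_le_inf.
    by exists (- L1 1 / 1); exists 1 => //=; exact: ltr01.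
  by move=> _ [a a0 <-]; exact: speed_ge0.
rewrite (le_lt_trans (L12 0) L20).
apply: lb_le_inf; first by exists (- L1 1 / 1); exists 1 => //=; exact: ltr01.
move=> _ [a /= a0 <-]; apply: (@le_trans _ _ (- L2 a / a)).
  (* The lower bound that [ge_inf] asks for is 0, as the quotients of [L2] are nonnegative. *)
  apply: ge_inf; last by exists a.
  by exists 0 => _ [b b0 <-]; exact: speed_ge0.
by rewrite ler_wpM2r ?invr_ge0 ?(ltW a0)// lerN2.
Qed.

End energy_bounds.

Theorem corollary2p5 (R : realType) (N : nat) (hN : (1 <= N)%N)
  (w : set 'rV[R]_N) (hw : smooth_bounded_domain w)
  (d D mu nu r : R) (hd : 0 < d) (hD : 0 < D) (hmu : 0 < mu) (hnu : 0 < nu)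
  (hr : 0 < r < 1)
  (f g : 'rV[R]_N -> R -> R)
  (f_reg : @C1_holder_on R ('rV[R]_N * R)%type r
             [set z | w z.1 /\ 0 <= z.2] (fun z => f z.1 z.2))
  (g_reg : @C1_holder_on R ('rV[R]_N * R)%type r
             [set z | bdry w z.1 /\ 0 <= z.2] (fun z => g z.1 z.2))
  (f0 : forall y, w y -> f y 0 = 0)
  (g0 : forall y, bdry w y -> g y 0 = 0)
  (f_kpp : forall y, w y ->
     forall v v', 0 < v -> v < v' -> f y v' / v' < f y v / v)
  (g_kpp : forall y, bdry w y ->
     forall u u', 0 < u -> u < u' -> g y u' / u' <= g y u / u)
  (fg_sat : exists M : R, 0 < M /\
     forall u v, M <= u -> M <= v ->
       (forall y, w y -> f y v <= 0) /\ (forall y, bdry w y -> g y u <= 0))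
  (kappa1 kappa2 : 'rV[R]_N -> R)
  (k1_reg : C1_holder_on r (bdry w) kappa1)
  (k2_reg : C1_holder_on r (bdry w) kappa2)
  (k1_ge0 : forall y, bdry w y -> 0 <= kappa1 y)
  (k2_ge0 : forall y, bdry w y -> 0 <= kappa2 y)
  (k1_neq0 : exists2 y, bdry w y & kappa1 y != 0)
  (k2_neq0 : exists2 y, bdry w y & kappa2 y != 0)
  (k12 : forall y, bdry w y -> kappa1 y <= kappa2 y) :
  spreading_speed w d D mu nu f g kappa1 >= spreading_speed w d D mu nu f g kappa2.
Proof.
have [_ bw _ _ _] := hw; have /andP[r0 _] := hr.
have bb := bounded_bdry N w bw.
have [Cf [Cf0 fC]] := rderiv0_bounded N r w f r0 bw f_reg.
have [Cg [Cg0 gC]] := rderiv0_bounded N r (bdry w) g r0 bb g_reg.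
have [K [K0 kK]] := C1_holder_on_bounded N r _ _ bb (closed_bdry N w) k2_reg.
apply: (spreading_speed_le_kappa N w d D mu nu f g hd hD Cf Cg Cf0 Cg0 fC gC
  kappa1 kappa2 K) => // y wy; first by rewrite k1_ge0 ?k12.
exact: le_trans (ler_norm _) (kK _ wy).
Qed.
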